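(* Let $(\mathscr{K},\otimes,1)$ be a tensor triangulated category and suppose that $(X,\sigma)$ is a classifying support data on $\mathscr{K}$. Then the canonical map $f:X\to\operatorname{Spc}(\mathscr{K})$, $f(x)=\{a\in\mathscr{K}\mid x\notin\sigma(a)\}$, is a homeomorphism.
   Context: All categories are essentially small. A tensor triangulated category $(\mathscr{K},\otimes,1)$ is a triangulated category $\mathscr{K}$ (translation functor $T$) with a symmetric monoidal product $\otimes:\mathscr{K}\times\mathscr{K}\to\mathscr{K}$ which is exact in each variable, with unit $1$. A thick $\otimes$-ideal of $\mathscr{K}$ is a full subcategory $\mathscr{A}$ containing $0$ such that: (a) for any distinguished triangle $a\to b\to c\to Ta$, if two of $a,b,c$ belong to $\mathscr{A}$ then so does the third; (b) if $a\in\mathscr{A}$ and $a\simeq b\oplus c$ in $\mathscr{K}$ then $b,c\in\mathscr{A}$; (c) if $a\in\mathscr{A}$ and $b\in\mathscr{K}$ then $a\otimes b\in\mathscr{A}$. A prime of $\mathscr{K}$ is a thick $\otimes$-ideal $\mathscr{P}\subsetneq\mathscr{K}$ such that $a\otimes b\in\mathscr{P}$ implies $a\in\mathscr{P}$ or $b\in\mathscr{P}$. $\operatorname{Spc}(\mathscr{K})$ is the set of all primes of $\mathscr{K}$, with the Zariski topology, whose closed subsets are the sets $Z(\mathscr{S})=\{\mathscr{P}\in\operatorname{Spc}(\mathscr{K})\mid\mathscr{S}\cap\mathscr{P}=\varnothing\}$ for collections of objects $\mathscr{S}\subset\mathscr{K}$. A support data on $\mathscr{K}$ is a pair $(X,\sigma)$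 where $X$ is a topological space and $\sigma$ assigns to each object $a\in\mathscr{K}$ a closed subset $\sigma(a)\subset X$ such that: (SD1) $\sigma(0)=\varnothing$ and $\sigma(1)=X$; (SD2) $\sigma(a\oplus b)=\sigma(a)\cup\sigma(b)$; (SD3) $\sigma(Ta)=\sigma(a)$; (SD4) $\sigma(a)\subset\sigma(b)\cup\sigma(c)$ for any distinguished triangle $a\to b\to c\to Ta$; (SD5) $\sigma(a\otimes b)=\sigma(a)\cap\sigma(b)$. A thick $\otimes$-ideal $\mathscr{J}$ is radical if $a^{\otimes n}\in\mathscr{J}$ for some $n\ge1$ implies $a\in\mathscr{J}$. A subset $Y$ of a topological space is specialization closed if it is a union of closed subsets. A support data $(X,\sigma)$ on $\mathscr{K}$ is classifying if: (a) $X$ is a noetherian topological space and any non-empty irreducible closed subset $Z\subset X$ has a unique generic point, i.e. there is a unique $x\in Z$ with $\overline{\{x\}}=Z$; (b) the assignment $Y\mapsto\{a\in\mathscr{K}\mid\sigma(a)\subset Y\}$ is a bijection from the set of specialization closed subsets of $X$ to the set of radical thick $\otimes$-ideals of $\mathscr{K}$, with inverse $\mathscr{J}\mapsto\sigma(\mathscr{J}):=\bigcup_{a\in\mathscr{J}}\sigma(a)$. *)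

(* Defs.v *)
From HB Require Import structures.
From mathcomp Require Import all_boot all_algebra.
From mathcomp Require Import all_classical topology.

Set Implicit Arguments.
Unset Strict Implicit.
Unset Printing Implicit Defensive.

Import GRing.Theory.

Local Open Scope classical_set_scope.
Local Open Scope ring_scope.

Reserved Notation "g \oc f" (at level 40, left associativity).

(** Smallness is built in: the objects form a type, the morphisms between two
    objects an abelian group. *)
Record preadditiveCat := PreadditiveCat {
  Ob :> Type;
  Hom : Ob -> Ob -> zmodType;
  idm : forall a, Hom a a;
  compm : forall a b c, Hom b c -> Hom a b -> Hom a c;
  comp1m : forall a b (f : Hom a b), compm (idm b) f = f;
  compm1 : forall a b (f : Hom a b), compm f (idm a) = f;
  compmA : forall a b c d (h : Hom c d) (g : Hom b c) (f : Hom a b),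
    compm h (compm g f) = compm (compm h g) f;
  compmDl : forall a b c (g g' : Hom b c) (f : Hom a b),
    compm (g + g') f = compm g f + compm g' f;
  compmDr : forall a b c (g : Hom b c) (f f' : Hom a b),
    compm g (f + f') = compm g f + compm g f'
}.
Arguments idm {_} _.

Notation "g \oc f" := (compm g f).

Definition inverse_mor (C : preadditiveCat) (a b : C)
    (f : Hom a b) (g : Hom b a) : Prop :=
  g \oc f = idm a /\ f \oc g = idm b.

Definition is_iso (C : preadditiveCat) (a b : C) (f : Hom a b) : Prop :=
  exists g : Hom b a, inverse_mor f g.

Definition isomorphic (C : preadditiveCat) (a b : C) : Prop :=
  exists f : Hom a b, is_iso f.

(** The zero object and the direct sums are chosen; as usual they are unique up
    to isomorphism. *)
Record additiveCat := AdditiveCat {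
  preadd :> preadditiveCat;
  zob : preadd;
  zob_terminal : forall (a : preadd) (f : Hom a zob), f = 0;
  zob_initial : forall (a : preadd) (f : Hom zob a), f = 0;
  dsum : preadd -> preadd -> preadd;
  dinl : forall a b, Hom a (dsum a b);
  dinr : forall a b, Hom b (dsum a b);
  dprl : forall a b, Hom (dsum a b) a;
  dprr : forall a b, Hom (dsum a b) b;
  dprl_inl : forall a b, dprl a b \oc dinl a b = idm a;
  dprr_inr : forall a b, dprr a b \oc dinr a b = idm b;
  dprl_inr : forall a b, dprl a b \oc dinr a b = 0;
  dprr_inl : forall a b, dprr a b \oc dinl a b = 0;
  dsum_id : forall a b,
    dinl a b \oc dprl a b + dinr a b \oc dprr a b = idm (dsum a b)
}.
Arguments zob {_}.

Record functor (C D : preadditiveCat) := Functor {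
  fob :> C -> D;
  fmor : forall a b, Hom a b -> Hom (fob a) (fob b);
  fmor1 : forall a, fmor (idm a) = idm (fob a);
  fmorM : forall a b c (g : Hom b c) (f : Hom a b),
    fmor (g \oc f) = fmor g \oc fmor f
}.
Arguments fmor {_ _} _ {_ _} _.

Definition functor_id (C : preadditiveCat) : functor C C.
Proof. by exists id (fun _ _ => id). Defined.

Definition functor_comp (C D E : preadditiveCat)
  (G : functor D E) (F : functor C D) : functor C E.
Proof.
exists (fun a => G (F a)) (fun _ _ f => fmor G (fmor F f)).
- by move=> a; rewrite !fmor1.
- by move=> a b c g f; rewrite !fmorM.
Defined.

Definition natural_iso (C D : preadditiveCat) (F G : functor C D)
    (t : forall a, Hom (F a) (G a)) : Prop :=
  (forall a, is_iso (t a)) /\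
  (forall a b (f : Hom a b), t b \oc fmor F f = fmor G f \oc t a).

Definition equivalence (C D : preadditiveCat) (F : functor C D) : Prop :=
  exists G : functor D C,
    (exists eta, @natural_iso C C (functor_id C) (functor_comp G F) eta) /\
    (exists eps, @natural_iso D D (functor_comp F G) (functor_id D) eps).

Definition additive_functor (C D : preadditiveCat) (F : functor C D) : Prop :=
  forall a b (f g : Hom a b), fmor F (f + g) = fmor F f + fmor F g.

(** [dist u v w] means that a --u--> b --v--> c --w--> T a is distinguished.
    [dist_iso], [dist_id], [dist_cone] form TR1; [dist_rot] is TR2; [dist_map]
    is TR3; [dist_oct] is the octahedral axiom TR4, in which c', a', b' are the
    cones of u, v and v \oc u. *)
Record triangulatedCat := TriangulatedCat {
  tadd :> additiveCat;
  shift : functor tadd tadd;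
  shift_additive : additive_functor shift;
  shift_equiv : equivalence shift;
  dist : forall a b c : tadd, Hom a b -> Hom b c -> Hom c (shift a) -> Prop;
  dist_iso : forall (a b c a' b' c' : tadd)
    (u : Hom a b) (v : Hom b c) (w : Hom c (shift a))
    (u' : Hom a' b') (v' : Hom b' c') (w' : Hom c' (shift a'))
    (f : Hom a a') (g : Hom b b') (h : Hom c c'),
    is_iso f -> is_iso g -> is_iso h ->
    g \oc u = u' \oc f -> h \oc v = v' \oc g ->
    fmor shift f \oc w = w' \oc h ->
    dist u v w -> dist u' v' w';
  dist_id : forall a : tadd,
    dist (idm a) (0 : Hom a zob) (0 : Hom zob (shift a));
  dist_cone : forall (a b : tadd) (u : Hom a b),
    exists c, exists v : Hom b c, exists w : Hom c (shift a), dist u v w;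
  dist_rot : forall (a b c : tadd)
    (u : Hom a b) (v : Hom b c) (w : Hom c (shift a)),
    dist u v w <-> dist v w (- fmor shift u);
  dist_map : forall (a b c a' b' c' : tadd)
    (u : Hom a b) (v : Hom b c) (w : Hom c (shift a))
    (u' : Hom a' b') (v' : Hom b' c') (w' : Hom c' (shift a'))
    (f : Hom a a') (g : Hom b b'),
    dist u v w -> dist u' v' w' -> g \oc u = u' \oc f ->
    exists h : Hom c c', h \oc v = v' \oc g /\ fmor shift f \oc w = w' \oc h;
  dist_oct : forall (a b c a' b' c' : tadd)
    (u : Hom a b) (i : Hom b c') (i' : Hom c' (shift a))
    (v : Hom b c) (j : Hom c a') (j' : Hom a' (shift b))
    (k : Hom c b') (k' : Hom b' (shift a)),
    dist u i i' -> dist v j j' -> dist (v \oc u) k k' ->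
    exists (f : Hom c' b') (g : Hom b' a'),
      [/\ dist f g (fmor shift i \oc j'),
          k \oc v = f \oc i, i' = k' \oc f,
          j = g \oc k & fmor shift u \oc k' = j' \oc g]
}.
Arguments shift {_}.
Arguments dist {_ _ _ _} _ _ _.

Definition exact_functor (C D : triangulatedCat) (F : functor C D) : Prop :=
  additive_functor F /\
  exists theta : forall a : C, Hom (F (shift a)) (shift (F a)),
    @natural_iso C D (functor_comp F shift) (functor_comp shift F) theta /\
    forall (a b c : C) (u : Hom a b) (v : Hom b c) (w : Hom c (shift a)),
      dist u v w -> dist (fmor F u) (fmor F v) (theta a \oc fmor F w).

Record bifunctor (C : preadditiveCat) := Bifunctor {
  bob :> C -> C -> C;
  bmor : forall a a' b b',
    Hom a a' -> Hom b b' -> Hom (bob a b) (bob a' b');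
  bmor1 : forall a b, bmor (idm a) (idm b) = idm (bob a b);
  bmorM : forall a a' a'' b b' b''
    (f' : Hom a' a'') (f : Hom a a') (g' : Hom b' b'') (g : Hom b b'),
    bmor (f' \oc f) (g' \oc g) = bmor f' g' \oc bmor f g
}.
Arguments bmor {_} _ {_ _ _ _} _ _.

Definition bifunctor_l (C : preadditiveCat) (B : bifunctor C) (a : C) :
  functor C C.
Proof.
exists (fun b => B a b) (fun _ _ g => bmor B (idm a) g).
- by move=> b; rewrite bmor1.
- by move=> b c d g f; rewrite -bmorM comp1m.
Defined.

Definition bifunctor_r (C : preadditiveCat) (B : bifunctor C) (b : C) :
  functor C C.
Proof.
exists (fun a => B a b) (fun _ _ f => bmor B f (idm b)).
- by move=> a; rewrite bmor1.
- by move=> a c d g f; rewrite -bmorM comp1m.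
Defined.

Record symMonoidal (C : preadditiveCat) := SymMonoidal {
  tensor : bifunctor C;
  tunit : C;
  tassoc : forall a b c,
    Hom (tensor (tensor a b) c) (tensor a (tensor b c));
  tlunit : forall a, Hom (tensor tunit a) a;
  trunit : forall a, Hom (tensor a tunit) a;
  tbraid : forall a b, Hom (tensor a b) (tensor b a);
  tassoc_iso : forall a b c, is_iso (tassoc a b c);
  tassoc_nat : forall a a' b b' c c'
    (f : Hom a a') (g : Hom b b') (h : Hom c c'),
    tassoc a' b' c' \oc bmor tensor (bmor tensor f g) h
    = bmor tensor f (bmor tensor g h) \oc tassoc a b c;
  tlunit_iso : forall a, is_iso (tlunit a);
  tlunit_nat : forall a a' (f : Hom a a'),
    tlunit a' \oc bmor tensor (idm tunit) f = f \oc tlunit a;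
  trunit_iso : forall a, is_iso (trunit a);
  trunit_nat : forall a a' (f : Hom a a'),
    trunit a' \oc bmor tensor f (idm tunit) = f \oc trunit a;
  tbraid_nat : forall a a' b b' (f : Hom a a') (g : Hom b b'),
    tbraid a' b' \oc bmor tensor f g = bmor tensor g f \oc tbraid a b;
  tbraid_sym : forall a b, tbraid b a \oc tbraid a b = idm (tensor a b);
  tpentagon : forall a b c d,
    tassoc a b (tensor c d) \oc tassoc (tensor a b) c d
    = bmor tensor (idm a) (tassoc b c d) \oc tassoc a (tensor b c) d
        \oc bmor tensor (tassoc a b c) (idm d);
  ttriangle : forall a b,
    bmor tensor (idm a) (tlunit b) \oc tassoc a tunit b
    = bmor tensor (trunit a) (idm b);
  thexagon : forall a b c,
    tassoc b c a \oc tbraid a (tensor b c) \oc tassoc a b c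
    = bmor tensor (idm b) (tbraid a c) \oc tassoc b a c
        \oc bmor tensor (tbraid a b) (idm c)
}.

Record ttCat := TTCat {
  ttri :> triangulatedCat;
  tmon : symMonoidal ttri;
  tensor_exactl : forall a : ttri,
    @exact_functor ttri ttri (bifunctor_l (tensor tmon) a);
  tensor_exactr : forall b : ttri,
    @exact_functor ttri ttri (bifunctor_r (tensor tmon) b)
}.

Definition tens (K : ttCat) (a b : K) : K := tensor (tmon K) a b.
Definition tone (K : ttCat) : K := tunit (tmon K).
Arguments tone {_}.

(** [tpow a n] is a for n = 1, and a (x) (a (x) ... (x) a) in general. *)
Definition tpow (K : ttCat) (a : K) (n : nat) : K :=
  iterop n (@tens K) a tone.

(** A full subcategory is identified with its set of objects. *)
Record thick_ideal (K : ttCat) (A : set K) : Prop := ThickIdeal {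
  thick0 : A zob;
  thick_triangle : forall (a b c : K)
    (u : Hom a b) (v : Hom b c) (w : Hom c (shift a)), dist u v w ->
    [/\ A a -> A b -> A c, A a -> A c -> A b & A b -> A c -> A a];
  thick_summand : forall a b c : K,
    A a -> isomorphic a (dsum b c) -> A b /\ A c;
  thick_tens : forall a b : K, A a -> A (tens a b)
}.

Record prime_ideal (K : ttCat) (P : set K) : Prop := PrimeIdeal {
  prime_thick : thick_ideal P;
  prime_proper : P `<` setT;
  prime_tens : forall a b : K, P (tens a b) -> P a \/ P b
}.

Definition radical_ideal (K : ttCat) (J : set K) : Prop :=
  thick_ideal J /\
  forall a : K, (exists2 n : nat, (1 <= n)%N & J (tpow a n)) -> J a.

Record Spc (K : ttCat) := SpcPoint {
  spc_set :> set K;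
  spc_prime : prime_ideal spc_set
}.

Definition zariski_closed (K : ttCat) (S : set K) : set (Spc K) :=
  [set P : Spc K | S `&` P = set0].

Section TriangulatedFacts.
Variable K : triangulatedCat.
Implicit Types a b c x : K.

Lemma compm0 a b c (g : Hom b c) : g \oc (0 : Hom a b) = 0.
Proof. by apply: (@addIr _ (g \oc 0)); rewrite -compmDr !add0r. Qed.

Lemma comp0m a b c (f : Hom a b) : (0 : Hom b c) \oc f = 0.
Proof. by apply: (@addIr _ (0 \oc f)); rewrite -compmDl !add0r. Qed.

Lemma shift0 a b : fmor shift (0 : Hom a b) = 0.
Proof.
by apply: (@addIr _ (fmor shift 0)); rewrite -shift_additive !add0r.
Qed.

Lemma is_iso_idm a : is_iso (idm a).
Proof. by exists (idm a); split; rewrite comp1m. Qed.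

Lemma isomorphic_refl a : isomorphic a a.
Proof. by exists (idm a); exact: is_iso_idm. Qed.

Lemma dist_comp0 a b c (u : Hom a b) (v : Hom b c) (w : Hom c (shift a)) :
  dist u v w -> v \oc u = 0.
Proof.
move=> D.
have [|h [<- _]] := @dist_map K _ _ _ _ _ _ _ _ _ _ _ _ (idm a) u
  (dist_id a) D; first by [].
by rewrite compm0.
Qed.

Lemma dist_of_iso a b (f : Hom a b) : is_iso f ->
  dist f (0 : Hom b zob) (0 : Hom zob (shift a)).
Proof.
move=> If.
apply: (dist_iso (is_iso_idm a) If (is_iso_idm zob) _ _ _ (dist_id a)).
- by [].
- by rewrite compm0 comp0m.
- by rewrite compm0 comp0m.
Qed.

Lemma shift_zob_iso : is_iso (0 : Hom (zob : K) (shift zob)).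
Proof.
exists 0; split; rewrite compm0; first exact/esym/zob_initial.
by rewrite -fmor1 (zob_terminal (idm (zob : K))) shift0.
Qed.

Lemma dist_0id x :
  dist (0 : Hom zob x) (idm x) (0 : Hom x (shift zob)).
Proof.
apply/dist_rot; rewrite shift0 oppr0.
apply: (dist_iso (is_iso_idm x) (is_iso_idm x) shift_zob_iso _ _ _ (dist_id x)).
- by [].
- by rewrite compm0 comp0m.
- by rewrite compm0 comp0m.
Qed.

Lemma dist_factor a b c (u : Hom a b) (v : Hom b c) (w : Hom c (shift a)) x
    (g : Hom b x) :
  dist u v w -> g \oc u = 0 -> exists h : Hom c x, h \oc v = g.
Proof.
move=> D gu0.
have [|h [hv _]] := @dist_map K _ _ _ _ _ _ _ _ _ _ _ _ (0 : Hom a zob) g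
  D (dist_0id x); first by rewrite gu0 comp0m.
by exists h; rewrite hv comp1m.
Qed.

Lemma dist_dsum a b :
  exists c, exists v : Hom (dsum a b) c, exists w : Hom c (shift a),
    dist (dinl a b) v w /\ isomorphic b c.
Proof.
have [c [v [w D]]] := dist_cone (dinl a b).
exists c, v, w; split=> //.
have [h hv] := dist_factor D (dprr_inl a b).
have D1 := (dist_rot _ _ _).1 D.
have D2 := (dist_rot _ _ _).1 D1.
have w0 : w = 0.
  have := dist_comp0 D2 => E.
  have Tw : fmor shift (dinl a b) \oc w = 0.
    apply: (@addrI _ (- fmor shift (dinl a b) \oc w)).
    by rewrite -compmDl addNr addr0 comp0m E.
  by rewrite -[w]comp1m -fmor1 -(dprl_inl a b) fmorM -compmA Tw compm0.
exists (v \oc dinr a b), h; split.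
  by rewrite compmA hv dprr_inr.
have E : (v \oc dinr a b \oc h - idm c) \oc v = 0.
  have vl := dist_comp0 D.
  have Ev : v \oc dinr a b \oc h \oc v = v.
    rewrite -(compmA _ h v) hv -[RHS]compm1 -(dsum_id a b) compmDr.
    by rewrite compmA vl comp0m add0r compmA.
  apply: (@addIr _ v).
  by rewrite -[X in _ + X]comp1m -compmDl subrK Ev add0r.
have [k /esym] := dist_factor D1 E.
by rewrite w0 compm0 => /eqP; rewrite subr_eq0 => /eqP.
Qed.

End TriangulatedFacts.

Section Thick.
Variables (K : ttCat) (A : set K).
Hypothesis thA : thick_ideal A.

Lemma thick_iso (a b : K) : isomorphic a b -> A a -> A b.
Proof.
move=> [f If] Aa.
have [_ + _] := thick_triangle thA (dist_of_iso If).
by apply=> //; exact: thick0.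
Qed.

Lemma thick_dsumE (a b : K) : A (dsum a b) <-> A a /\ A b.
Proof.
split=> [Aab | [Aa Ab]].
  exact: (thick_summand thA Aab (isomorphic_refl _)).
have [c [v [w [D bc]]]] := dist_dsum a b.
have [_ + _] := thick_triangle thA D.
by apply=> //; exact: thick_iso bc Ab.
Qed.

End Thick.

Section SpcTopology.
Variable K : ttCat.

Let op : set_system (Spc K) :=
  [set U | exists S : set K, ~` U = zariski_closed S].

Let opT : op setT.
Proof.
exists setT; rewrite setCT; apply/seteqP; split=> // P; rewrite /zariski_closed/=.
by rewrite setTI => P0; have := thick0 (prime_thick (spc_prime P)); rewrite P0.
Qed.

Let opI : setI_closed op.
Proof.
move=> U V [S US] [S' VS'].
exists [set d | exists a b, [/\ S a, S' b & d = dsum a b]].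
rewrite setCI US VS'; apply/seteqP; split=> P.
- move=> SP; apply/seteqP; split=> // d [[a [b [Sa S'b ->]]]].
  move=> /(thick_dsumE (prime_thick (spc_prime P)))[Pa Pb].
  by case: SP => /seteqP[+ _]; [move/(_ a); apply|move/(_ b); apply].
- move=> H; apply: contrapT => /not_orP[/eqP/set0P[a [Sa Pa]]].
  move=> /eqP/set0P[b [S'b Pb]].
  have /seteqP[+ _] := H; move/(_ (dsum a b)); apply; split.
    by exists a, b.
  exact/(thick_dsumE (prime_thick (spc_prime P))).
Qed.

Let op_bigU (J : Type) (f : J -> set (Spc K)) :
  (forall i, op (f i)) -> op (\bigcup_i f i).
Proof.
move=> /choice[S fS]; exists (\bigcup_i S i).
rewrite setC_bigcup /zariski_closed; apply/seteqP; split=> P /=.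
- move=> H; rewrite setI_bigcupl; apply: bigcup0 => i _.
  by have := H i I; rewrite fS.
- move=> H i _; rewrite fS /zariski_closed /=; apply/seteqP; split=> // a [Sa Pa].
  by have /seteqP[+ _] := H; move/(_ a); apply; split=> //; exists i.
Qed.

HB.instance Definition _ := gen_eqMixin (Spc K).
HB.instance Definition _ := gen_choiceMixin (Spc K).
HB.instance Definition _ := isOpenTopological.Build (Spc K) opT opI op_bigU.

Lemma closed_SpcP (C : set (Spc K)) :
  closed C <-> exists S : set K, C = zariski_closed S.
Proof.
rewrite -openC; split=> -[S] H; exists S; first by rewrite -H setCK.
by rewrite setCK.
Qed.

End SpcTopology.

Record support_data (K : ttCat) (X : topologicalType) := SupportData {
  supp :> K -> set X;
  supp_closed : forall a, closed (supp a);
  supp0 : supp zob = set0;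
  supp1 : supp tone = setT;
  supp_dsum : forall a b : K, supp (dsum a b) = supp a `|` supp b;
  supp_shift : forall a : K, supp (shift a) = supp a;
  supp_dist : forall (a b c : K)
    (u : Hom a b) (v : Hom b c) (w : Hom c (shift a)),
    dist u v w -> supp a `<=` supp b `|` supp c;
  supp_tens : forall a b : K, supp (tens a b) = supp a `&` supp b
}.
Arguments supp_dist {_ _} _ {_ _ _ _ _ _} _.

Definition noetherian_space (X : topologicalType) : Prop :=
  forall F : nat -> set X,
    (forall n, closed (F n)) -> (forall n, F n.+1 `<=` F n) ->
    exists N, forall n, (N <= n)%N -> F n = F N.

Definition irreducible (X : topologicalType) (Z : set X) : Prop :=
  Z !=set0 /\
  forall A B : set X, closed A -> closed B ->
    Z `<=` A `|` B -> Z `<=` A \/ Z `<=` B.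

Definition generic_point (X : topologicalType) (Z : set X) (x : X) : Prop :=
  Z x /\ closure [set x] = Z.

Definition specialization_closed (X : topologicalType) (Y : set X) : Prop :=
  exists2 F : set (set X), F `<=` closed & Y = \bigcup_(C in F) C.

Definition homeomorphism (X Y : topologicalType) (f : X -> Y) : Prop :=
  exists g : Y -> X,
    [/\ cancel f g, cancel g f, continuous f & continuous g].

Section Classifying.
Variables (K : ttCat) (X : topologicalType) (sigma : support_data K X).

Definition supported_on (Y : set X) : set K := [set a | sigma a `<=` Y].

Definition supp_ideal (J : set K) : set X := \bigcup_(a in J) sigma a.

Definition classifying : Prop :=
  [/\ noetherian_space X,
      forall Z : set X, closed Z -> irreducible Z ->
        exists! x, generic_point Z x,
      set_bij (@specialization_closed X) (@radical_ideal K) supported_on,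
      forall Y, specialization_closed Y -> supp_ideal (supported_on Y) = Y
    & forall J, radical_ideal J -> supported_on (supp_ideal J) = J].

Lemma supp_iso (a b : K) : isomorphic a b -> sigma a `<=` sigma b.
Proof. by move=> [f /dist_of_iso/(supp_dist sigma)]; rewrite supp0 setU0. Qed.

Lemma canonical_prime (x : X) : prime_ideal [set a : K | ~ sigma a x].
Proof.
split; first split=> /=.
- by rewrite supp0.
- move=> a b c u v w D.
  have D1 := (dist_rot _ _ _).1 D; have D2 := (dist_rot _ _ _).1 D1.
  have s1 := supp_dist sigma D x; have s2 := supp_dist sigma D1 x.
  have s3 := supp_dist sigma D2 x; rewrite !supp_shift in s1 s2 s3.
  split=> n1 n2 n3.
  + by case: (s3 n3).
  + by case: (s2 n3).
  + by case: (s1 n3).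
- move=> a b c na [f [g [gf fg]]].
  have /supp_iso/(_ x) : isomorphic (dsum b c) a by exists g, f.
  by rewrite supp_dsum => H; split=> n; apply/na/H; [left|right].
- by move=> a b na; rewrite supp_tens => -[].
- split=> // /(_ tone I) /=; by rewrite supp1; apply.
- move=> a b /=; rewrite supp_tens => nab.
  by apply: contrapT => /not_orP[/contrapT ? /contrapT ?]; apply: nab.
Qed.

Definition canonical_map (x : X) : Spc K := SpcPoint (canonical_prime x).

End Classifying.

(* Main.v *)
Require Import Defs.
From mathcomp Require Import all_boot all_algebra.
From mathcomp Require Import all_classical topology.

Set Implicit Arguments.
Unset Strict Implicit.
Unset Printing Implicit Defensive.

Local Open Scope classical_set_scope.

(** The theorem rests on one fact: for a classifying support data every closed
    subset of X is the support of a single object ([closed_suppE]). If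
    Z is the support of a, a point x lies in Z exactly when a is not in f(x), so
    f identifies the closed sets of X with the traces on f(X) of the closed sets
    of Spc(K). As the uniqueness of generic points makes f injective, it is a
    homeomorphism onto its image, and only surjectivity remains.

    For surjectivity, let P be a prime. It is radical, hence determined by the
    supports of its objects: an object whose support lies in that of an object
    of P is in P. The supports of the objects outside P are closed under
    intersection, because P is prime, so the noetherian hypothesis yields a
    smallest one, Z. A closed set that does not contain Z is then the support
    of an object of P, and since P is stable under direct sums Z is irreducible.
    The generic point x of Z lies in the support of a exactly when Z does, that
    is, exactly when a is not in P: thus P is the image of x.

    The fact itself is proved by noetherian induction. A reducible closed set
    is the union of two smaller ones, supports of a and b, hence the support of
    their direct sum. If Z is irreducible with generic point x, then since Z is
    the union of the supports contained in it, one of them contains x, hence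
    the closure of x, which is all of Z. *)

(** If F had no minimal element, then choosing again and again a strictly
    smaller member of F would produce a descending chain that never becomes
    stationary. *)
Lemma noetherian_minimal (X : topologicalType) (F : set (set X)) :
  noetherian_space X -> F `<=` closed -> F !=set0 ->
  exists2 Z, F Z & forall W, F W -> W `<=` Z -> W = Z.
Proof.
move=> noeth clF [Z0 FZ0]; apply: contrapT => nomin.
have /choice[next nextP] (Z : set X) :
    exists W, F Z -> [/\ F W, W `<=` Z & W <> Z].
  have [FZ|nFZ] := pselect (F Z); last by exists Z.
  apply: contrapT => noW; apply: nomin; exists Z => // W FW WZ.
  by apply: contrapT => WneZ; apply: noW; exists W.
pose chain n := iter n next Z0.
have Fchain n : F (chain n) by elim: n => //= n /nextP[].
have [n||N stat] := noeth chain; first exact: clF.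
  by move=> n; have [] := nextP _ (Fchain n).
by have [_ _] := nextP _ (Fchain N); apply; exact: (stat N.+1).
Qed.

Lemma closure1_sub (X : topologicalType) (x : X) (Z : set X) :
  closed Z -> Z x -> closure [set x] `<=` Z.
Proof.
move=> clZ Zx; rewrite [X in _ `<=` X](closure_id Z).1 //.
by apply: closureS => _ ->.
Qed.

Lemma closure1_irreducible (X : topologicalType) (x : X) :
  irreducible (closure [set x]).
Proof.
have xx : closure [set x] x by exact: subset_closure.
split; first by exists x.
move=> A B clA clB /(_ x xx)[Ax|Bx]; [left|right]; exact: closure1_sub.
Qed.

Lemma prime_radical (K : ttCat) (P : set K) : prime_ideal P -> radical_ideal P.
Proof.
move=> [thP _ primeP]; split=> // a [[//|n] _].
elim: n => [//|n IHn]; rewrite /tpow.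
by move=> /primeP[//|]; exact: IHn.
Qed.

Section Classifying.
Variables (K : ttCat) (X : topologicalType) (sigma : support_data K X).
Hypothesis hsigma : classifying sigma.

(** A radical ideal J is the set of objects supported on a subset of X, so
    membership in J depends only on the support. *)
Lemma radical_supp_sub (J : set K) (a b : K) :
  radical_ideal J -> J b -> sigma a `<=` sigma b -> J a.
Proof.
have [_ _ _ _ JE] := hsigma.
by move=> /JE<- Jb ab; apply: subset_trans Jb.
Qed.

(** Noetherian induction, run on a minimal closed set W that is not a support.
    Its proper closed subsets are supports, so W is irreducible, as a union of
    two supports is the support of a direct sum; but an irreducible W is
    covered by the supports it contains, and the one through its generic point
    exhausts it. *)
Lemma closed_suppE (Z : set X) : closed Z -> exists a : K, sigma a = Z.
Proof.
have [noeth gen _ suppE _] := hsigma.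
move=> clZ; apply: contrapT => nZ.
pose bad := [set W : set X | closed W /\ ~ exists a : K, sigma a = W].
have [||W [clW nW] minW] := @noetherian_minimal X bad noeth.
- by move=> W [].
- by exists Z.
have good V : closed V -> V `<=` W -> ~ W `<=` V -> exists a : K, sigma a = V.
  move=> clV VW WV; apply: contrapT => nV.
  by apply: WV; rewrite (minW V).
have [irrW|redW] := pselect (irreducible W).
  have [x [[Wx xW] _]] := gen W clW irrW.
  have : supp_ideal sigma (supported_on sigma W) x.
    by rewrite suppE //; exists [set W] => [_ ->//|]; rewrite bigcup_set1.
  move=> [a aW ax]; apply: nW; exists a; apply/seteqP; split=> //.
  by rewrite -xW; apply: closure1_sub => //; exact: supp_closed.
apply: redW; split.
  by apply/set0P/eqP => W0; apply: nW; exists zob; rewrite W0 supp0.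
move=> A B clA clB WAB; apply: contrapT => /not_orP[nA nB].
have [||a aE] := good (W `&` A) (closedI clW clA); first exact: subIsetl.
  by rewrite subsetI => -[].
have [||b bE] := good (W `&` B) (closedI clW clB); first exact: subIsetl.
  by rewrite subsetI => -[].
apply: nW; exists (dsum a b).
by rewrite supp_dsum aE bE -setIUr; apply/setIidPl.
Qed.

(** Points with the same image lie in the same supports, hence in the same
    closed sets; each is then generic in the closure of the other. *)
Lemma canonical_map_inj : injective (canonical_map sigma).
Proof.
have [_ gen _ _ _] := hsigma.
move=> x y /(congr1 (@spc_set K)) fxy.
have same a : sigma a x <-> sigma a y.
  have /(congr1 (@^~ a)) /= := fxy.
  by move=> nE; split=> ?; apply: contrapT; rewrite ?nE // -nE.
have same_closed C : closed C -> C x <-> C y.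
  by move=> /closed_suppE[a <-].
have clx (z : X) : closed (closure [set z]) by exact: closed_closure.
have cl_self (z : X) : closure [set z] z by exact: subset_closure.
have xy : closure [set y] = closure [set x].
  apply/seteqP; split; apply: closure1_sub => //.
  - exact/(same_closed _ (clx x)).
  - exact/(same_closed _ (clx y)).
have [z [_ zP]] := gen _ (clx x) (closure1_irreducible x).
by rewrite -(zP x) ?(zP y) //; split=> //; rewrite -xy.
Qed.

(** The supports of the objects outside P are closed under intersection, since
    a tensor product of two such objects stays outside P. A minimal one, which
    exists by noetherianity, is therefore the smallest. *)
Lemma prime_min_support (P : set K) : prime_ideal P ->
  exists2 m : K, ~ P m & forall a, ~ P a -> sigma m `<=` sigma a.
Proof.
move=> primeP; have [noeth _ _ _ _] := hsigma.
have [||_ [m nPm <-] minm] :=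
    @noetherian_minimal X [set sigma a | a in ~` P] noeth.
- by move=> _ [a _ <-]; exact: supp_closed.
- have [_ TP] := prime_proper primeP.
  apply: contrapT => none; apply: TP => a _; apply: contrapT => nPa.
  by apply: none; exists (sigma a), a.
exists m => // a nPa.
rewrite -(minm (sigma m `&` sigma a)); first exact: subIsetr.
  exists (tens m a); last exact: supp_tens.
  by move=> /(prime_tens primeP)[].
exact: subIsetl.
Qed.

(** The preimage of P is the generic point of the smallest support of an object
    outside P. *)
Lemma canonical_map_surj (P : Spc K) : exists x, canonical_map sigma x = P.
Proof.
have [_ gen _ _ _] := hsigma.
case: P => P primeP.
have thP := prime_thick primeP; have radP := prime_radical primeP.
have [m nPm mP] := prime_min_support primeP.
(* Membership in P can now be read off from the one closed set sigma m. *)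
have outP a : sigma m `<=` sigma a <-> ~ P a.
  by split=> [ma Pa|/mP//]; apply: nPm; exact: radical_supp_sub ma.
have irr : irreducible (sigma m).
  split.
    apply/set0P/eqP => m0; apply: nPm.
    by apply: (radical_supp_sub radP (thick0 thP)); rewrite m0.
  move=> _ _ /closed_suppE[a <-] /closed_suppE[b <-].
  rewrite -supp_dsum => /outP nPab; rewrite !outP.
  by apply/not_andP => -[Pa Pb]; apply: nPab; exact/(thick_dsumE thP).
have [x [[mx xm] _]] := gen _ (@supp_closed _ _ sigma m) irr.
have E : [set a : K | ~ sigma a x] = P.
  apply/seteqP; split=> a /=.
    by move=> nax; apply: contrapT => /outP ma; apply: nax; exact: ma.
  move=> Pa ax; move: Pa; apply/outP.
  by rewrite -xm; apply: closure1_sub => //; exact: supp_closed.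
(* The points of Spc carry a proof of primality, so the equality of the
   underlying sets is transported before the proofs are identified. *)
exists x; rewrite /canonical_map; case: _ / E primeP {thP radP nPm mP outP} => pr.
by congr SpcPoint; exact: Prop_irrelevance.
Qed.

Lemma canonical_map_continuous : continuous (canonical_map sigma).
Proof.
apply/continuous_closedP => _ /closed_SpcP[S ->].
have -> : canonical_map sigma @^-1` zariski_closed S = \bigcap_(a in S) sigma a.
  apply/seteqP; split=> x /=.
    move=> /seteqP[+ _] a Sa; move=> /(_ a) H.
    by apply: contrapT => nax; apply: H.
  by move=> Sx; apply/seteqP; split=> // a [Sa]; apply; exact: Sx.
by apply: closed_bigI => a _; exact: supp_closed.
Qed.

(** As every closed set is the support of one object a, its image is the basic
    closed set of the primes that do not contain a; surjectivity is what makes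
    the image all of it. *)
Lemma canonical_map_closed (Z : set X) :
  closed Z -> closed (canonical_map sigma @` Z).
Proof.
move=> /closed_suppE[a <-]; apply/closed_SpcP; exists [set a].
apply/seteqP; split=> [_ [x ax <-]|P aP].
  by apply/seteqP; split=> // _ [->] /=.
have [x xP] := canonical_map_surj P; exists x => //.
apply: contrapT => nax; have /seteqP[+ _] := aP.
by move=> /(_ a); apply; split=> //; rewrite -xP.
Qed.

End Classifying.

Theorem theorem5p2 (K : ttCat) (X : topologicalType) (sigma : support_data K X)
    (hsigma : classifying sigma) :
  homeomorphism (canonical_map sigma).
Proof.
have /choice[g fg] := canonical_map_surj hsigma.
have gf : cancel (canonical_map sigma) g.
  by move=> x; apply: (canonical_map_inj hsigma); rewrite fg.
exists g; split=> //; first exact: canonical_map_continuous.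
apply/continuous_closedP => Z /(canonical_map_closed hsigma).
congr closed; apply/seteqP; split=> [_ [x Zx <-]|P ZgP] /=; first by rewrite gf.
by exists (g P).
Qed.
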